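(* The double inequality $$\sqrt{\left(\lambda\cosh t+1-\lambda\right)\frac{\sinh t}{t}}<I_0(t)<\sqrt{\left(\delta\cosh t+1-\delta\right)\frac{\sinh t}{t}}$$ holds for all $t>0$ if and only if $\lambda\in[0,2/\pi]$ and $\delta\in[\delta_0,\infty)$, where $\delta_0\approx 0.67664$ is defined by $$\delta_0=\frac{t_0 I_0(t_0)^2-\sinh t_0}{(\cosh t_0-1)\sinh t_0},$$ and here $t_0$ is the unique solution on $(0,\infty)$ of the equation $$\frac{d}{dt}\left(\frac{tI_0(t)^2-\sinh t}{(\cosh t-1)\sinh t}\right)=0.$$
   Context: $I_0(t)=\sum_{n=0}^{\infty}\frac{t^{2n}}{2^{2n}(n!)^2}$ denotes the modified Bessel function of the first kind of order $0$.
   Formalization: At δ=δ0 the right inequality is an equality at t=t0, so the strict double inequality is stated iff λ∈[0,2/π] and δ>δ0; with ≤ on the right it is iff δ≥δ0; and for δ≥δ0 equality on the right occurs only for δ=δ0, t=t0. *)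

(* Defs.v *)
(* Stdlib reals with Coquelicot. *)
From Stdlib Require Export Reals Factorial.
From Coquelicot Require Export Coquelicot.
Open Scope R_scope.

Definition besselI0 (t : R) : R :=
  Series (fun n : nat => t ^ (2 * n) / (2 ^ (2 * n) * (INR (fact n)) ^ 2)).

Definition radicand (p t : R) : R := (p * cosh t + 1 - p) * (sinh t / t).

(* [sqrt] is 0 on negative reals, so an inequality between real square roots
   also has to assert that they exist; for p < 0 the radicand is negative at
   large t. *)
Definition sqrt_defined (p t : R) : Prop := 0 <= radicand p t.

Definition sqrt_bound (p t : R) : R := sqrt (radicand p t).

(* For t > 0, ratio t is the value of p at which sqrt_bound p t = besselI0 t. *)
Definition ratio (t : R) : R :=
  (t * besselI0 t ^ 2 - sinh t) / ((cosh t - 1) * sinh t).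

Definition critical_point (t : R) : Prop := 0 < t /\ is_derive ratio t 0.

(* Main.v *)
Require Import Defs.
From Stdlib Require Import Reals.
From Coquelicot Require Import Coquelicot.
From Stdlib Require Import Lra Lia Classical.
From mathcomp Require ssreflect ssrbool ssrnat fintype bigop binomial.
Open Scope R_scope.

(** The proof expands the square of the Bessel function.  By Vandermonde's identity
    I0(t)^2 is the sum of (2n)! / (4^n n!^4) t^(2n), so with x = t^2

      ratio t = (sum c_n d_n x^n) / (sum d_n x^n),  d_n = (4^m - 1) / (2m+1)!,
      c_n = (4^m W_m - 1) / (4^m - 1),  m = n + 1,

    where W_m = (2m)! (2m+1)! / (16^m m!^4) is the Wallis ratio, which decreases
    to 2/PI.  The bound sqrt_bound p t lies below or above I0(t) exactly as p lies
    below or above ratio t, so everything is a statement about the range of ratio.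

    The coefficients satisfy c_0 = 2/3 < c_1 > c_2 > ..., with limit 2/PI < 2/3.
    - Every c_n exceeds 2/PI, hence so does ratio; and the limit of the c_n makes
      2/PI the greatest lower bound (below_ratio_iff).
    - One rise followed by a decrease of the coefficients forces ratio to rise and
      then fall.  Write P and Q for the two series.  The coefficients of P' and Q'
      have decreasing quotients, so P'/Q' decreases (quotient_decreasing, by a
      Descartes-type argument on sign changes); this makes P'Q - PQ' pass from
      positive to negative only once (wronskian_crosses_down).  It is positive at 0
      because c_0 < c_1, and it is not always positive because P/Q starts at 2/3
      and comes down near 2/PI.  Its zero gives t0, the unique critical point and
      the strict maximum of ratio (ratio_unimodal).
    - The value of the maximum is located by truncating series: the upper bound holds
      at every x > 0 because the discarded terms are negative and the remaining polynomial
      has an explicit certificate of sign (quotient_upper); the lower bound is an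
      evaluation at one rational x close to t0^2 (quotient_lower). *)

(** * Entire power series *)

Definition entire (a : nat -> R) : Prop := forall x : R, ex_pseries a x.

(** Convergence at every point puts each [x] strictly inside the disk of convergence,
    where series can be multiplied and differentiated term by term. *)
Lemma entire_radius (a : nat -> R) (x : R) :
  entire a -> Rbar_lt (Rabs x) (CV_radius a).
Proof.
  intros Ha.
  destruct (Rbar_lt_le_dec (Rabs x) (CV_radius a)) as [H | H]; [exact H | exfalso].
  assert (Ho : Rbar_lt (CV_radius a) (Rabs (Rabs x + 1))).
  { apply Rbar_le_lt_trans with (1 := H). simpl.
    rewrite (Rabs_pos_eq (Rabs x + 1)); generalize (Rabs_pos x); lra. }
  apply (CV_disk_outside _ _ Ho).
  apply ex_series_lim_0.
  apply ex_pseries_R, Ha.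
Qed.

Lemma entire_dominated (a b : nat -> R) :
  entire b -> (forall n, Rabs (a n) <= b n) -> entire a.
Proof.
  intros Hb Hab x.
  apply ex_pseries_R.
  apply (ex_series_le (V := R_CompleteNormedModule) _ (fun n => b n * Rabs x ^ n)).
  - intros n. change (Rabs (a n * x ^ n) <= b n * Rabs x ^ n).
    rewrite Rabs_mult, <- RPow_abs.
    apply Rmult_le_compat_r; [apply pow_le, Rabs_pos | apply Hab].
  - apply ex_pseries_R, Hb.
Qed.

Lemma entire_ext (a b : nat -> R) :
  (forall n, a n = b n) -> entire a -> entire b.
Proof.
  intros H Ha x. apply (ex_pseries_ext a b x H), Ha.
Qed.

Lemma entire_derive (a : nat -> R) : entire a -> entire (PS_derive a).
Proof. intros Ha x. apply ex_pseries_derive, entire_radius, Ha. Qed.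

Lemma entire_tail (a : nat -> R) : entire a -> entire (PS_decr_1 a).
Proof.
  intros Ha x. apply (ex_pseries_decr_1 a x); [|apply Ha].
  destruct (Req_dec x 0) as [H | H]; [left; exact H | right].
  exists (/ x). apply Rinv_l, H.
Qed.

Lemma entire_minus (a b : nat -> R) :
  entire a -> entire b -> entire (fun n => a n - b n).
Proof.
  intros Ha Hb x. apply (ex_pseries_minus a b x); auto.
Qed.

Lemma PSeries_sub (a b : nat -> R) (x : R) :
  entire a -> entire b ->
  PSeries (fun n => a n - b n) x = PSeries a x - PSeries b x.
Proof. intros Ha Hb. apply (PSeries_minus a b x); auto. Qed.

Lemma entire_scal (r : R) (a : nat -> R) :
  entire a -> entire (fun n => r * a n).
Proof.
  intros Ha x. apply ex_pseries_R.
  apply (ex_series_ext (fun n => scal r (a n * x ^ n))).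
  - intros n. unfold scal; simpl; unfold mult; simpl. ring.
  - apply (ex_series_scal (V := R_NormedModule) r), ex_pseries_R, Ha.
Qed.

Lemma entire_dilate (m : R) (a : nat -> R) :
  entire a -> entire (fun n => m ^ n * a n).
Proof.
  intros Ha x. apply ex_pseries_R.
  apply (ex_series_ext (fun n => a n * (m * x) ^ n)).
  - intros n. change (a n * (m * x) ^ n = m ^ n * a n * x ^ n). rewrite Rpow_mult_distr. ring.
  - apply ex_pseries_R, Ha.
Qed.

Lemma PSeries_dilate (m : R) (a : nat -> R) (x : R) :
  PSeries (fun n => m ^ n * a n) x = PSeries a (m * x).
Proof.
  apply Series_ext. intros n. rewrite Rpow_mult_distr. ring.
Qed.

Lemma is_derive_entire (a : nat -> R) (x : R) :
  entire a -> is_derive (PSeries a) x (PSeries (PS_derive a) x).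
Proof. intros Ha. apply is_derive_PSeries, entire_radius, Ha. Qed.

Lemma PSeries_nonneg (a : nat -> R) (x : R) :
  (forall n, 0 <= a n) -> entire a -> 0 <= x -> 0 <= PSeries a x.
Proof.
  intros Ha He Hx.
  rewrite <- (PSeries_const_0 x).
  apply Series_le.
  - intros n. rewrite Rmult_0_l. split; [lra|].
    apply Rmult_le_pos; [apply Ha | apply pow_le, Hx].
  - apply ex_pseries_R, He.
Qed.

Lemma PSeries_pos (a : nat -> R) (x : R) :
  (forall n, 0 < a n) -> entire a -> 0 <= x -> 0 < PSeries a x.
Proof.
  intros Ha He Hx.
  rewrite PSeries_decr_1 by apply He.
  assert (0 <= PSeries (PS_decr_1 a) x).
  { apply PSeries_nonneg; [intros n; left; apply Ha | apply entire_tail, He | exact Hx]. }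
  generalize (Ha 0%nat); nra.
Qed.

Lemma PSeries_coef_le (a b : nat -> R) (x : R) :
  entire a -> entire b -> (forall n, a n <= b n) -> 0 <= x ->
  PSeries a x <= PSeries b x.
Proof.
  intros Ha Hb H Hx.
  assert (0 <= PSeries (fun n => b n - a n) x).
  { apply PSeries_nonneg; [|apply entire_minus; assumption | exact Hx].
    intros n; specialize (H n); lra. }
  rewrite PSeries_sub in H0 by assumption. lra.
Qed.

Lemma PSeries_incr (a : nat -> R) (x y : R) :
  (forall n, 0 <= a n) -> entire a -> 0 <= x <= y -> PSeries a x <= PSeries a y.
Proof.
  intros Ha He Hx.
  apply Series_le.
  - intros n. split.
    + apply Rmult_le_pos; [apply Ha | apply pow_le; lra].
    + apply Rmult_le_compat_l; [apply Ha | apply pow_incr; lra].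
  - apply ex_pseries_R, He.
Qed.

Lemma PSeries_drop_zero (a b : nat -> R) (x : R) :
  a 0%nat = 0 -> (forall n, a (S n) = b n) -> PSeries a x = x * PSeries b x.
Proof.
  intros H0 H. rewrite PSeries_decr_1_aux by exact H0.
  f_equal. apply PSeries_ext, H.
Qed.

Lemma entire_shift (n : nat) (a : nat -> R) : entire a -> entire (fun k => a (n + k)%nat).
Proof.
  revert a. induction n as [|n IH]; intros a Ha; [exact Ha|].
  apply (IH (fun k => a (S k))), (entire_tail a Ha).
Qed.

Lemma PSeries_split (a : nat -> R) (n : nat) (x : R) :
  entire a ->
  PSeries a x = sum_f_R0 (fun k => a k * x ^ k) n +
    x ^ S n * PSeries (fun k => a (S n + k)%nat) x.
Proof. intros Ha. apply PSeries_decr_n, Ha. Qed.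

Lemma PSeries_le_geometric (a : nat -> R) (x : R) :
  (forall n, 0 <= a n) -> entire a -> 0 <= x -> (forall n, a (S n) * x <= a n / 2) ->
  PSeries a x <= 2 * a 0%nat.
Proof.
  intros Ha Ea Hx H.
  assert (Hb : forall n, a n * x ^ n <= a 0%nat * (/ 2) ^ n).
  { induction n as [|n IH]; [simpl; lra|].
    generalize (pow_le x n Hx) (H n); simpl; intros. nra. }
  assert (Hs : Rabs (/ 2) < 1) by (rewrite Rabs_pos_eq; lra).
  apply Rle_trans with (Series (fun n => a 0%nat * (/ 2) ^ n)).
  - apply Series_le.
    + intros n. split; [apply Rmult_le_pos; [apply Ha | apply pow_le, Hx] | apply Hb].
    + apply (ex_series_scal (V := R_NormedModule) (a 0%nat)), ex_series_geom, Hs.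
  - rewrite Series_scal_l, Series_geom by exact Hs. lra.
Qed.

(** * Sign changes of the coefficients and monotonicity *)

Lemma strictly_decreasing_lt (c : nat -> R) :
  (forall n, c (S n) < c n) -> forall m n, (m < n)%nat -> c n < c m.
Proof.
  intros H m n Hmn. induction Hmn; [apply H | apply Rlt_trans with (2 := IHHmn), H].
Qed.

(** The half of Descartes' rule that is used: a series with nonnegative coefficients
    followed by negative ones, once it is nonpositive, strictly decreases.  Removing
    the constant term and dividing by the variable shortens the nonnegative block by
    one and keeps the series nonpositive at [x]; hence the induction on [k]. *)
Lemma sign_change_decreasing (k : nat) :
  forall a : nat -> R, entire a ->
  (forall n, (n < k)%nat -> 0 <= a n) -> (forall n, (k <= n)%nat -> a n < 0) ->
  forall x y : R, 0 < x < y -> PSeries a x <= 0 -> PSeries a y < PSeries a x.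
Proof.
  induction k as [|k IH]; intros a He Hp Hn x y Hxy Hx.
  - assert (Hm : forall z, PSeries (PS_decr_1 a) z = - PSeries (fun n => -1 * PS_decr_1 a n) z).
    { intros z. generalize (PSeries_scal (-1) (PS_decr_1 a) z).
      unfold PS_scal, scal; simpl; unfold mult; simpl. lra. }
    assert (E : entire (fun n => -1 * PS_decr_1 a n)) by apply entire_scal, entire_tail, He.
    assert (Hpos : forall n, 0 < -1 * PS_decr_1 a n).
    { intros n. unfold PS_decr_1. specialize (Hn (S n)). assert (a (S n) < 0) by (apply Hn; lia). lra. }
    rewrite !(PSeries_decr_1 a) by apply He.
    rewrite !Hm.
    assert (H1 := PSeries_incr _ x y (fun n => Rlt_le _ _ (Hpos n)) E ltac:(lra)).
    assert (H2 := PSeries_pos _ x Hpos E ltac:(lra)).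
    nra.
  - rewrite (PSeries_decr_1 a x) in * by apply He.
    rewrite (PSeries_decr_1 a y) by apply He.
    assert (H0 : 0 <= a 0%nat) by (apply Hp; lia).
    assert (Hx1 : PSeries (PS_decr_1 a) x <= 0) by nra.
    assert (H1 : PSeries (PS_decr_1 a) y < PSeries (PS_decr_1 a) x).
    { apply IH; auto using entire_tail.
      - intros n Hk. apply Hp. lia.
      - intros n Hk. apply Hn. lia. }
    nra.
Qed.

(** The margin [e] is what makes the induction on [N] close: multiplied by a large
    [y], it absorbs the constant term that the induction step puts back. *)
Lemma eventually_negative (N : nat) :
  forall a : nat -> R, entire a -> (forall n, (N <= n)%nat -> a n < 0) ->
  exists e Y : R, 0 < e /\ 0 < Y /\ forall y, Y <= y -> PSeries a y <= - e.
Proof.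
  induction N as [|N IH]; intros a He Hn.
  - exists (- a 0%nat), 1. split; [|split; [lra|]].
    + generalize (Hn 0%nat ltac:(lia)); lra.
    + intros y Hy. rewrite PSeries_decr_1 by apply He.
      assert (H := PSeries_coef_le (PS_decr_1 a) (fun _ => 0) y (entire_tail a He)).
      rewrite PSeries_const_0 in H.
      assert (PSeries (PS_decr_1 a) y <= 0); [|nra].
      apply H; [|intros n; left; apply Hn; lia|lra].
      intros x. apply CV_radius_inside. rewrite CV_radius_const_0. exact I.
  - destruct (IH (PS_decr_1 a) (entire_tail a He)) as (e & Y & He0 & HY & H).
    { intros n Hk. apply Hn. lia. }
    set (Z := (Rabs (a 0%nat) + e) / e).
    exists e, (Rmax Y Z). split; [exact He0|split].
    + apply Rlt_le_trans with (1 := HY), Rmax_l.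
    + intros y Hy.
      assert (Hy1 : Y <= y) by (apply Rle_trans with (2 := Hy), Rmax_l).
      assert (Hy2 : Z <= y) by (apply Rle_trans with (2 := Hy), Rmax_r).
      rewrite PSeries_decr_1 by apply He.
      specialize (H y Hy1).
      assert (Rabs (a 0%nat) + e <= y * e).
      { replace (Rabs (a 0%nat) + e) with (Z * e) by (unfold Z; field; lra). nra. }
      generalize (Rle_abs (a 0%nat)); nra.
Qed.

Lemma first_below (c : nat -> R) (r : R) (n : nat) :
  c n < r -> exists k, c k < r /\ forall j, (j < k)%nat -> r <= c j.
Proof.
  revert c. induction n as [|n IH]; intros c Hn.
  - exists 0%nat. split; [exact Hn | intros; lia].
  - destruct (Rlt_le_dec (c 0%nat) r) as [H0 | H0].
    + exists 0%nat. split; [exact H0 | intros; lia].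
    + destruct (IH (fun i => c (S i)) Hn) as (k & Hk & Hj).
      exists (S k). split; [exact Hk|].
      intros [|j] Hl; [exact H0 | apply Hj; lia].
Qed.

(** Subtracting from the numerator the multiple [rho] of the denominator that makes it
    vanish at [x] leaves coefficients [(c n - rho) * q n] with a single change of
    sign, so the difference is negative beyond [x]. *)
Lemma quotient_decreasing (c q : nat -> R) (x y : R) :
  entire q -> entire (fun n => c n * q n) ->
  (forall n, 0 < q n) -> (forall n, c (S n) < c n) -> 0 < x < y ->
  PSeries (fun n => c n * q n) y / PSeries q y <
  PSeries (fun n => c n * q n) x / PSeries q x.
Proof.
  intros Eq Ep Hq Hc Hxy.
  assert (Hqx := PSeries_pos q x Hq Eq ltac:(lra)).
  assert (Hqy := PSeries_pos q y Hq Eq ltac:(lra)).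
  set (rho := PSeries (fun n => c n * q n) x / PSeries q x).
  assert (Eg : entire (fun n => c n * q n - rho * q n))
    by (apply entire_minus; [exact Ep | apply entire_scal, Eq]).
  assert (Hg : forall z, PSeries (fun n => c n * q n - rho * q n) z =
     PSeries (fun n => c n * q n) z - rho * PSeries q z).
  { intros z. rewrite PSeries_sub; [|exact Ep | apply entire_scal, Eq].
    f_equal. apply (PSeries_scal rho q). }
  assert (Hgx : PSeries (fun n => c n * q n - rho * q n) x = 0).
  { rewrite Hg. unfold rho. field. lra. }
  assert (Hex : exists n, c n < rho).
  { destruct (classic (exists n, c n < rho)) as [H | H]; [exact H | exfalso].
    assert (Hall : forall n, rho <= c n).
    { intros n. apply Rnot_lt_le. intros Hn. apply H. exists n. exact Hn. }
    assert (0 < PSeries (fun n => c n * q n - rho * q n) x); [|lra].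
    apply PSeries_pos; [|exact Eg | lra].
    intros n. specialize (Hall (S n)). specialize (Hc n). specialize (Hq n). nra. }
  destruct Hex as (n & Hn).
  destruct (first_below c rho n Hn) as (k & Hk & Hj).
  assert (H : PSeries (fun n => c n * q n - rho * q n) y < PSeries (fun n => c n * q n - rho * q n) x).
  { apply (sign_change_decreasing k); auto; [| | lra].
    - intros i Hi. specialize (Hj i Hi). specialize (Hq i). nra.
    - intros i Hi. specialize (Hq i).
      assert (c i < rho); [|nra].
      destruct (Compare_dec.le_lt_eq_dec k i Hi) as [Hl | ->]; [|exact Hk].
      apply Rlt_trans with (2 := Hk), strictly_decreasing_lt; assumption. }
  rewrite Hgx, Hg in H.
  apply Rmult_lt_reg_r with (PSeries q y); [exact Hqy|].
  unfold Rdiv at 1. rewrite Rmult_assoc, Rinv_l by lra. lra.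
Qed.

(** * A quotient of power series with one turning point *)

(** The numerator of the derivative of the quotient of the two series.  Unlike that
    derivative it is continuous on the whole line, zeros of the denominator included. *)
Definition wronskian (p q : nat -> R) (x : R) : R :=
  PSeries (PS_derive p) x * PSeries q x - PSeries p x * PSeries (PS_derive q) x.

Lemma quotient_deriv (p q : nat -> R) (x : R) :
  entire p -> entire q -> PSeries q x <> 0 ->
  is_derive (fun z => PSeries p z / PSeries q z) x
    (wronskian p q x / PSeries q x ^ 2).
Proof.
  intros Ep Eq H.
  exact (is_derive_div _ _ x _ _ (is_derive_entire p x Ep) (is_derive_entire q x Eq) H).
Qed.

Lemma wronskian_continuous (p q : nat -> R) :
  entire p -> entire q -> continuity (wronskian p q).
Proof.
  intros Ep Eq x.
  assert (C : forall a, entire a -> continuity_pt (PSeries a) x).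
  { intros a Ha. apply PSeries_continuity, entire_radius, Ha. }
  apply continuity_pt_minus; apply continuity_pt_mult; apply C; auto using entire_derive.
Qed.

Section Unimodal.
Context (c q : nat -> R).
Let p (n : nat) : R := c n * q n.
Context (Eq : entire q) (Ep : entire p) (Hq : forall n, 0 < q n).
Context (Hc0 : c 0%nat < c 1%nat) (Hc : forall n, c (S (S n)) < c (S n)).

Lemma denominator_pos (x : R) : 0 <= x -> 0 < PSeries q x.
Proof. apply PSeries_pos; assumption. Qed.

(** For positive arguments the sign of the wronskian is the sign of [rho * Q - P] with
    [rho = P' / Q'].  As [rho] decreases, [P' >= rho y * Q'] between [x] and [y], so that
    [P - rho y * Q] is at least as large at [y] as at [x]; and at [x] it exceeds
    [P - rho x * Q], which is nonnegative there. *)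
Lemma wronskian_crosses_down (x y : R) :
  0 < x < y -> wronskian p q x <= 0 -> wronskian p q y < 0.
Proof.
  intros Hxy. unfold wronskian.
  assert (Hdq : forall n, 0 < PS_derive q n).
  { intros n. apply Rmult_lt_0_compat; [apply lt_0_INR; lia | apply Hq]. }
  assert (Edq := entire_derive q Eq).
  (* The factor n + 1 cancels, so the quotients of coefficients are again those of c,
     now without c 0, the one that breaks monotonicity. *)
  assert (Hext : forall n, PS_derive p n = c (S n) * PS_derive q n).
  { intros n. unfold PS_derive, p. ring. }
  assert (Edp := entire_ext _ _ Hext (entire_derive p Ep)).
  assert (HdP : forall z, PSeries (PS_derive p) z =
     PSeries (fun n => c (S n) * PS_derive q n) z).
  { intros z. apply PSeries_ext, Hext. }
  pose (rho z := PSeries (PS_derive p) z / PSeries (PS_derive q) z).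
  assert (Hdec : forall u v, 0 < u < v -> rho v < rho u).
  { intros u v Huv. unfold rho. rewrite !HdP.
    apply (quotient_decreasing (fun n => c (S n))); assumption. }
  assert (HQ : forall z, 0 < z -> 0 < PSeries (PS_derive q) z).
  { intros z Hz. apply PSeries_pos; [assumption..|lra]. }
  assert (HR : forall z, 0 < z -> PSeries (PS_derive p) z = rho z * PSeries (PS_derive q) z).
  { intros z Hz. unfold rho. field. generalize (HQ z Hz); lra. }
  clearbody rho.
  rewrite !HR by lra. intros Hx.
  assert (Hx' : rho x * PSeries q x <= PSeries p x)
    by (apply Rmult_le_reg_r with (1 := HQ x ltac:(lra)); lra).
  assert (Hxy' := Hdec x y Hxy).
  destruct (MVT_cor2 (fun z => PSeries p z - rho y * PSeries q z)
    (fun z => PSeries (PS_derive p) z - rho y * PSeries (PS_derive q) z) x y) as (z & Hz & Hxz).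
  { lra. }
  { intros z Hz. apply is_derive_Reals.
    apply (is_derive_minus (V := R_NormedModule)); [apply is_derive_entire, Ep|].
    apply (is_derive_scal (PSeries q) z (rho y)), is_derive_entire, Eq. }
  assert (Hyz := Hdec z y ltac:(lra)).
  rewrite (HR z) in Hz by lra.
  assert (Hz' : 0 <= (rho z * PSeries (PS_derive q) z - rho y * PSeries (PS_derive q) z) * (y - x)).
  { apply Rmult_le_pos; [|lra].
    generalize (Rmult_lt_compat_r _ _ _ (HQ z ltac:(lra)) Hyz); lra. }
  assert (Hqx := denominator_pos x ltac:(lra)).
  assert (rho y * PSeries q x < rho x * PSeries q x) by (apply Rmult_lt_compat_r; assumption).
  assert (rho y * PSeries q y < PSeries p y) by lra.
  assert (Hy := Rmult_lt_compat_r _ _ _ (HQ y ltac:(lra)) H0).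
  lra.
Qed.

(** The hypothesis at [X] says that the quotient has come back to its value at 0 or
    below, so by the mean value theorem its derivative is nonpositive somewhere before
    [X]. *)
Lemma wronskian_one_root (X : R) :
  0 < X -> PSeries p X <= c 0%nat * PSeries q X ->
  exists x0 : R, 0 < x0 /\ wronskian p q x0 = 0 /\
    (forall x, 0 < x < x0 -> 0 < wronskian p q x) /\
    (forall x, x0 < x -> wronskian p q x < 0).
Proof.
  intros HX Hle.
  assert (HW0 : 0 < wronskian p q 0).
  { unfold wronskian. rewrite !PSeries_0. unfold PS_derive, p. simpl INR.
    generalize (Hq 0) (Hq 1); intros.
    assert (0 < q 0%nat * q 1%nat) by nra.
    nra. }
  assert (Hneg : exists z, 0 < z /\ wronskian p q z <= 0).
  { destruct (MVT_cor2 (fun z => PSeries p z / PSeries q z)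
      (fun z => wronskian p q z / PSeries q z ^ 2) 0 X HX) as (z & Hz & Hz0).
    { intros z Hz. apply is_derive_Reals, quotient_deriv; auto.
      generalize (denominator_pos z ltac:(lra)); lra. }
    exists z. split; [lra|].
    assert (HQz := denominator_pos z ltac:(lra)).
    assert (HQX := denominator_pos X ltac:(lra)).
    rewrite !PSeries_0 in Hz. unfold p at 2 in Hz.
    replace (c 0%nat * q 0%nat / q 0%nat) with (c 0%nat) in Hz
      by (field; generalize (Hq 0); lra).
    assert (PSeries p X / PSeries q X <= c 0%nat).
    { apply Rmult_le_reg_r with (1 := HQX). unfold Rdiv.
      rewrite Rmult_assoc, Rinv_l by lra. lra. }
    assert (H1 : wronskian p q z / PSeries q z ^ 2 <= 0) by nra.
    assert (H2 : 0 < PSeries q z ^ 2) by (apply pow_lt; exact HQz).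
    replace (wronskian p q z) with (wronskian p q z / PSeries q z ^ 2 * PSeries q z ^ 2)
      by (field; lra).
    nra. }
  destruct Hneg as (z & Hz & HWz).
  destruct (IVT_gen (wronskian p q) 0 z 0) as (x0 & Hx0 & HWx0).
  { apply wronskian_continuous; assumption. }
  { rewrite Rmin_right, Rmax_left by lra. lra. }
  rewrite Rmin_left in Hx0 by lra.
  assert (0 < x0).
  { destruct (proj1 Hx0) as [H | H]; [exact H|]. rewrite <- H in HWx0. lra. }
  exists x0. repeat split; [assumption..| |].
  - intros x Hx. apply Rnot_le_lt. intros Hn.
    generalize (wronskian_crosses_down x x0 Hx Hn); lra.
  - intros x Hx. apply (wronskian_crosses_down x0); lra.
Qed.

Lemma quotient_max (x0 x : R) :
  0 < x0 ->
  (forall x, 0 < x < x0 -> 0 < wronskian p q x) ->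
  (forall x, x0 < x -> wronskian p q x < 0) ->
  0 < x -> x <> x0 -> PSeries p x / PSeries q x < PSeries p x0 / PSeries q x0.
Proof.
  intros Hx0 Hl Hr Hx Hne.
  assert (D : forall z, 0 < z -> derivable_pt_lim (fun z => PSeries p z / PSeries q z) z
      (wronskian p q z / PSeries q z ^ 2)).
  { intros z Hz. apply is_derive_Reals, quotient_deriv; auto.
    generalize (denominator_pos z ltac:(lra)); lra. }
  assert (I : forall z, 0 < z -> 0 < / PSeries q z ^ 2).
  { intros z Hz. apply Rinv_0_lt_compat, pow_lt, denominator_pos. lra. }
  destruct (Rtotal_order x x0) as [H | [H | H]]; [|contradiction|].
  - destruct (MVT_cor2 _ _ x x0 H (fun z Hz => D z ltac:(lra))) as (z & Hz & Hz0).
    specialize (Hl z ltac:(lra)). specialize (I z ltac:(lra)).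
    assert (0 < wronskian p q z / PSeries q z ^ 2) by (apply Rmult_lt_0_compat; assumption).
    nra.
  - destruct (MVT_cor2 _ _ x0 x H (fun z Hz => D z ltac:(lra))) as (z & Hz & Hz0).
    specialize (Hr z ltac:(lra)). specialize (I z ltac:(lra)).
    assert (wronskian p q z / PSeries q z ^ 2 < 0) by (unfold Rdiv; nra).
    nra.
Qed.
End Unimodal.

(** * The Wallis ratio and its limit *)

Definition wallis (n : nat) : R :=
  INR (fact (2 * n)) * INR (fact (2 * n + 1)) / (16 ^ n * INR (fact n) ^ 4).

Lemma wallis_0 : wallis 0 = 1.
Proof. unfold wallis. simpl. field. Qed.

Lemma wallis_succ (n : nat) :
  wallis (S n) =
  wallis n * ((2 * INR n + 1) * (2 * INR n + 3)) / (2 * INR n + 2) ^ 2.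
Proof.
  unfold wallis.
  replace (2 * S n)%nat with (S (S (2 * n))) by lia.
  replace (S (S (2 * n)) + 1)%nat with (S (S (2 * n + 1))) by lia.
  rewrite !fact_simpl, !mult_INR, !S_INR, plus_INR, mult_INR. simpl INR.
  generalize (pos_INR n) (INR_fact_neq_0 n); intros.
  assert (16 ^ n <> 0) by (apply pow_nonzero; lra).
  simpl pow. field. repeat split; auto; lra.
Qed.

Lemma wallis_pos (n : nat) : 0 < wallis n.
Proof.
  unfold wallis. generalize (INR_fact_lt_0 n) (INR_fact_lt_0 (2 * n)) (INR_fact_lt_0 (2 * n + 1)).
  intros. apply Rdiv_lt_0_compat; [nra|].
  apply Rmult_lt_0_compat; apply pow_lt; lra.
Qed.

Lemma wallis_decr (n : nat) : wallis (S n) < wallis n.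
Proof.
  rewrite wallis_succ. generalize (wallis_pos n) (pos_INR n); intros.
  apply Rmult_lt_reg_r with ((2 * INR n + 2) ^ 2); [apply pow_lt; lra|].
  unfold Rdiv. rewrite Rmult_assoc, Rinv_l by (apply pow_nonzero; lra).
  simpl; nra.
Qed.

Lemma wallis_le_1 (n : nat) : wallis n <= 1.
Proof.
  induction n as [|n IH]; [rewrite wallis_0; lra | generalize (wallis_decr n); lra].
Qed.

Definition wallis_integral (n : nat) : R := RInt (fun x => sin x ^ n) 0 (PI / 2).

Lemma sin_pow_integrable (n : nat) : ex_RInt (fun x => sin x ^ n) 0 (PI / 2).
Proof.
  apply (ex_RInt_continuous (V := R_CompleteNormedModule)). intros x _.
  apply (ex_derive_continuous (V := R_NormedModule)). auto_derive. exact I.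
Qed.

Lemma wallis_integral_0 : wallis_integral 0 = PI / 2.
Proof.
  unfold wallis_integral. simpl pow. rewrite RInt_const. unfold scal; simpl; unfold mult; simpl. ring.
Qed.

Lemma wallis_integral_1 : wallis_integral 1 = 1.
Proof.
  unfold wallis_integral. apply is_RInt_unique.
  replace 1 with (minus (- cos (PI / 2)) (- cos 0)).
  2:{ unfold minus, plus, opp; simpl. rewrite cos_PI2, cos_0. ring. }
  apply (is_RInt_derive (V := R_CompleteNormedModule) (fun x => - cos x)).
  - intros x _. auto_derive; [exact I | ring].
  - intros x _. apply (ex_derive_continuous (V := R_NormedModule)). auto_derive. exact I.
Qed.

(** Integration by parts, in the form of the antiderivative [cos x * sin x ^ (n + 1)],
    which vanishes at both ends. *)
Lemma wallis_integral_step (n : nat) :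
  (INR n + 2) * wallis_integral (S (S n)) = (INR n + 1) * wallis_integral n.
Proof.
  assert (H : is_RInt (fun x => (INR n + 1) * sin x ^ n - (INR n + 2) * sin x ^ S (S n)) 0 (PI / 2) 0).
  { replace 0 with (minus (cos (PI / 2) * sin (PI / 2) ^ S n) (cos 0 * sin 0 ^ S n)) at 2.
    2:{ unfold minus, plus, opp; simpl. rewrite cos_PI2, sin_0. ring. }
    apply (is_RInt_derive (V := R_CompleteNormedModule) (fun x => cos x * sin x ^ S n)).
    - intros x _. auto_derive; [exact I|].
      change (Init.Nat.pred (S n)) with n.
      change (match n with O => 1 | S _ => INR n + 1 end) with (INR (S n)). rewrite S_INR.
      assert (Hc : cos x * cos x = 1 - sin x * sin x).
      { generalize (sin2_cos2 x); unfold Rsqr; lra. }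
      simpl pow.
      transitivity ((INR n + 1) * sin x ^ n * (cos x * cos x) - sin x * sin x * sin x ^ n); [ring|].
      rewrite Hc. ring.
    - intros x _. apply (ex_derive_continuous (V := R_NormedModule)). auto_derive. exact I. }
  assert (K : is_RInt (fun x => (INR n + 1) * sin x ^ n - (INR n + 2) * sin x ^ S (S n)) 0 (PI / 2)
    ((INR n + 1) * wallis_integral n - (INR n + 2) * wallis_integral (S (S n)))).
  { apply (is_RInt_minus (V := R_NormedModule));
      apply (is_RInt_scal (V := R_NormedModule));
      apply (RInt_correct (V := R_CompleteNormedModule)), sin_pow_integrable. }
  apply (is_RInt_unique (V := R_CompleteNormedModule)) in K.
  apply (is_RInt_unique (V := R_CompleteNormedModule)) in H.
  rewrite H in K. lra.
Qed.

Lemma wallis_integral_decr (n : nat) : wallis_integral (S n) <= wallis_integral n.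
Proof.
  apply RInt_le; [generalize PI_RGT_0; lra | apply sin_pow_integrable.. |].
  intros x Hx.
  assert (0 <= sin x) by (apply sin_ge_0; generalize PI_RGT_0; lra).
  generalize (SIN_bound x) (pow_le (sin x) n H). simpl. nra.
Qed.

Lemma wallis_integral_pos (n : nat) : 0 < wallis_integral n /\ 0 < wallis_integral (S n).
Proof.
  induction n as [|n [IH1 IH2]].
  - rewrite wallis_integral_0, wallis_integral_1. generalize PI_RGT_0; lra.
  - split; [exact IH2|]. generalize (wallis_integral_step n) (pos_INR n); intros. nra.
Qed.

Lemma wallis_integral_even (n : nat) :
  wallis_integral (2 * n) = PI / 2 * wallis n * wallis_integral (2 * n + 1).
Proof.
  induction n as [|n IH].
  - rewrite wallis_0. simpl. rewrite wallis_integral_0, wallis_integral_1. ring.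
  - generalize (wallis_integral_step (2 * n)) (wallis_integral_step (2 * n + 1)).
    replace (2 * S n)%nat with (S (S (2 * n))) by lia.
    replace (S (S (2 * n)) + 1)%nat with (S (S (2 * n + 1))) by lia.
    rewrite wallis_succ, plus_INR, mult_INR. simpl INR.
    generalize (pos_INR n); intros Hn H1 H2.
    replace (wallis_integral (S (S (2 * n)))) with ((2 * INR n + 1) * wallis_integral (2 * n) / (2 * INR n + 2)).
    2:{ apply Rmult_eq_reg_l with (2 * INR n + 2); [|lra]. transitivity ((2 * INR n + 1) * wallis_integral (2 * n)); [field; lra|lra]. }
    replace (wallis_integral (S (S (2 * n + 1)))) with ((2 * INR n + 2) * wallis_integral (2 * n + 1) / (2 * INR n + 3)).
    2:{ apply Rmult_eq_reg_l with (2 * INR n + 3); [|lra]. transitivity ((2 * INR n + 2) * wallis_integral (2 * n + 1)); [field; lra|lra]. }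
    rewrite IH. field. lra.
Qed.

(** The two bounds on the Wallis ratio compare consecutive integrals of powers of the
    sine, which decrease with the exponent. *)
Lemma wallis_lower (n : nat) : 2 / PI <= wallis n.
Proof.
  generalize PI_RGT_0 (wallis_integral_decr (2 * n)) (wallis_integral_pos (2 * n)); intros Hpi H [_ H1].
  replace (S (2 * n)) with (2 * n + 1)%nat in * by lia.
  rewrite wallis_integral_even in H.
  assert (1 <= PI / 2 * wallis n) by (apply Rmult_le_reg_r with (1 := H1); lra).
  apply Rmult_le_reg_l with (PI / 2); [lra|].
  replace (PI / 2 * (2 / PI)) with 1 by (field; lra). lra.
Qed.

Lemma wallis_upper (n : nat) : wallis (S n) <= 2 / PI * (1 + / (2 * INR n + 2)).
Proof.
  generalize PI_RGT_0 (wallis_integral_decr (2 * n + 1)) (wallis_integral_pos (2 * n + 1))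
    (wallis_integral_step (2 * n + 1)) (pos_INR n) (wallis_integral_even (S n)).
  replace (2 * S n)%nat with (S (2 * n + 1)) by lia.
  replace (S (2 * n + 1) + 1)%nat with (S (S (2 * n + 1))) by lia.
  rewrite plus_INR, mult_INR. simpl INR.
  set (M := wallis_integral (2 * n + 1)).
  intros Hpi H [H1 H2] H3 Hn H4.
  assert (E : wallis_integral (S (S (2 * n + 1))) = (2 * INR n + 2) / (2 * INR n + 3) * M).
  { apply Rmult_eq_reg_l with (2 * INR n + 3); [|lra].
    transitivity ((2 * INR n + 2) * M); [lra | field; lra]. }
  rewrite E in H4. rewrite H4 in H.
  assert (0 < (2 * INR n + 2) / (2 * INR n + 3)) by (apply Rdiv_lt_0_compat; lra).
  apply Rmult_le_reg_l with (PI / 2 * ((2 * INR n + 2) / (2 * INR n + 3)) * M).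
  { apply Rmult_lt_0_compat; [apply Rmult_lt_0_compat|]; lra. }
  apply Rle_trans with M; [lra|]. right. field. lra.
Qed.

Lemma wallis_lim : is_lim_seq wallis (2 / PI).
Proof.
  apply is_lim_seq_incr_1.
  apply (is_lim_seq_le_le (fun _ => 2 / PI) _ (fun n => 2 / PI * (1 + / (2 * INR n + 2)))).
  - intros n. split; [apply wallis_lower | apply wallis_upper].
  - apply is_lim_seq_const.
  - replace (Finite (2 / PI)) with (Finite (2 / PI * (1 + 0))) by (f_equal; ring).
    apply is_lim_seq_mult'; [apply is_lim_seq_const|].
    apply is_lim_seq_plus'; [apply is_lim_seq_const|].
    apply (is_lim_seq_le_le (fun _ => 0) _ (fun n => / INR (S n))).
    + intros n. rewrite S_INR. generalize (pos_INR n); intros. split.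
      * left. apply Rinv_0_lt_compat. lra.
      * apply Rinv_le_contravar; lra.
    + apply is_lim_seq_const.
    + apply (is_lim_seq_incr_1 (fun n => / INR n)).
      replace (Finite 0) with (Rbar_inv p_infty) by reflexivity.
      apply is_lim_seq_inv; [apply is_lim_seq_INR | discriminate].
Qed.

(** * The quotients of coefficients *)

(** The quotient of the coefficients of [x ^ n] in the numerator and the denominator
    of the ratio; the common factor [t ^ 3] shifts the index of the Wallis ratio by 1. *)
Definition ratio_coef (n : nat) : R :=
  (4 ^ S n * wallis (S n) - 1) / (4 ^ S n - 1).

Lemma pow4_gt_1 (n : nat) : 1 < 4 ^ S n.
Proof. apply Rlt_pow_R1; [lra | lia]. Qed.

Lemma ratio_coef_eq (n : nat) :
  ratio_coef n = wallis (S n) - (1 - wallis (S n)) / (4 ^ S n - 1).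
Proof. unfold ratio_coef. field. generalize (pow4_gt_1 n); lra. Qed.

Lemma wallis_1 : wallis 1 = 3 / 4.
Proof. rewrite wallis_succ, wallis_0. simpl. field. Qed.

Lemma wallis_2 : wallis 2 = 45 / 64.
Proof. rewrite wallis_succ, wallis_1. simpl. field. Qed.

Lemma wallis_3 : wallis 3 = 175 / 256.
Proof. rewrite wallis_succ, wallis_2. simpl. field. Qed.

Lemma ratio_coef_0 : ratio_coef 0 = 2 / 3.
Proof. unfold ratio_coef. rewrite wallis_1. field. Qed.

Lemma ratio_coef_1 : ratio_coef 1 = 41 / 60.
Proof. unfold ratio_coef. rewrite wallis_2. field. Qed.

Lemma wallis_ge_half (n : nat) : 1 / 2 <= wallis n.
Proof.
  apply Rle_trans with (2 := wallis_lower n).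
  generalize PI_RGT_0 PI_4; intros. apply Rmult_le_reg_r with PI; [lra|].
  replace (2 / PI * PI) with 2 by (field; lra). lra.
Qed.

(** With [m = n + 4] and [z = 4 ^ (n + 3)] this yields
    [12 * z * m ^ 2 < (z - 1) * (4 * z - 1)], which is what [ratio_coef_decr] needs once
    denominators are cleared and [1 - w] is bounded by [w], for a Wallis ratio
    [w >= 1 / 2]. *)
Lemma pow4_beats_square (n : nat) :
  12 * (INR n + 4) ^ 2 + 5 <= 4 * 4 ^ (n + 3).
Proof.
  induction n as [|n IH]; [simpl; lra|].
  rewrite S_INR. simpl plus. change (4 ^ S (n + 3)) with (4 * 4 ^ (n + 3)).
  generalize (pos_INR n); intros. simpl in *. nra.
Qed.

(** By [ratio_coef_eq] the coefficient is the Wallis ratio, whose decrease is of order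
    [1 / n ^ 2], minus a correction of order [1 / 4 ^ n].  The first dominates the
    second from index 2 on; the remaining comparison is numerical. *)
Lemma ratio_coef_decr (n : nat) : ratio_coef (S (S n)) < ratio_coef (S n).
Proof.
  destruct n as [|n].
  { rewrite ratio_coef_1. unfold ratio_coef. rewrite wallis_3. lra. }
  rewrite !ratio_coef_eq.
  assert (Hh := wallis_ge_half (S (S (S n)))).
  assert (H1 := wallis_le_1 (S (S (S n)))).
  rewrite (wallis_succ (S (S (S n)))).
  set (w := wallis (S (S (S n)))) in *.
  change (4 ^ S (S (S (S n)))) with (4 * 4 ^ S (S (S n))).
  replace (S (S (S n))) with (n + 3)%nat by lia.
  generalize (pow4_beats_square n). rewrite plus_INR. simpl INR.
  set (z := 4 ^ (n + 3)). set (m := INR n + 4).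
  assert (Hm : 4 <= m) by (unfold m; generalize (pos_INR n); lra).
  intros Hz.
  replace (2 * (INR n + (1 + 1 + 1)) + 1) with (2 * m - 1) by (unfold m; ring).
  replace (2 * (INR n + (1 + 1 + 1)) + 3) with (2 * m + 1) by (unfold m; ring).
  replace (2 * (INR n + (1 + 1 + 1)) + 2) with (2 * m) by (unfold m; ring).
  assert (Hz' : 48 < z) by nra.
  apply Rminus_lt_0.
  replace (w - (1 - w) / (z - 1) -
    (w * ((2 * m - 1) * (2 * m + 1)) / (2 * m) ^ 2 -
      (1 - w * ((2 * m - 1) * (2 * m + 1)) / (2 * m) ^ 2) / (4 * z - 1)))
  with ((w * (z - 1) * (4 * z - 1) - 3 * z * (1 - w) * (4 * m ^ 2) + w * (z - 1))
     / (4 * m ^ 2 * (z - 1) * (4 * z - 1))) by (field; lra).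
  apply Rdiv_lt_0_compat.
  2:{ repeat apply Rmult_lt_0_compat; try lra; simpl; nra. }
  assert (0 < z * m ^ 2) by (apply Rmult_lt_0_compat; [lra | apply pow_lt; lra]).
  assert (12 * (z * m ^ 2) < (z - 1) * (4 * z - 1)) by nra.
  assert (0 < w * (z - 1)) by nra.
  nra.
Qed.

Lemma ratio_coef_lim : is_lim_seq ratio_coef (2 / PI).
Proof.
  apply (is_lim_seq_le_le (fun n => wallis (S n) - / INR (S n)) _ (fun n => wallis (S n))).
  - intros n. rewrite ratio_coef_eq.
    assert (Hw := wallis_le_1 (S n)). assert (Hp := wallis_pos (S n)).
    assert (H4 := pow4_gt_1 n).
    assert (Hn : INR (S n) <= 4 ^ S n - 1).
    { clear. induction n as [|n IH]; [simpl; lra|].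
      rewrite S_INR. change (4 ^ S (S n)) with (4 * 4 ^ S n).
      generalize (pos_INR n). rewrite S_INR in *. lra. }
    assert (Hi : / (4 ^ S n - 1) <= / INR (S n)).
    { apply Rinv_le_contravar; [apply lt_0_INR; lia | exact Hn]. }
    assert (0 < / (4 ^ S n - 1)) by (apply Rinv_0_lt_compat; lra).
    unfold Rdiv. split; nra.
  - replace (Finite (2 / PI)) with (Finite (2 / PI - 0)) by (f_equal; ring).
    apply is_lim_seq_minus'; [apply (is_lim_seq_incr_1 wallis), wallis_lim|].
    apply (is_lim_seq_incr_1 (fun n => / INR n)).
    replace (Finite 0) with (Rbar_inv p_infty) by reflexivity.
    apply is_lim_seq_inv; [apply is_lim_seq_INR | discriminate].
  - apply (is_lim_seq_incr_1 wallis), wallis_lim.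
Qed.

Lemma two_over_PI_lt : 2 / PI < 2 / 3.
Proof.
  apply Rmult_lt_compat_l; [lra|]. apply Rinv_lt_contravar; generalize PI2_3_2; lra.
Qed.

(** From index 1 on the sequence strictly decreases to [2 / PI]; index 0 lies outside
    that range and is covered by [PI > 3]. *)
Lemma ratio_coef_gt (n : nat) : 2 / PI < ratio_coef n.
Proof.
  destruct n as [|n]; [rewrite ratio_coef_0; apply two_over_PI_lt|].
  apply Rle_lt_trans with (ratio_coef (S (S n))); [|apply ratio_coef_decr].
  apply (is_lim_seq_decr_compare (fun n => ratio_coef (S n)) (2 / PI)).
  - apply (is_lim_seq_incr_1 ratio_coef), ratio_coef_lim.
  - intros k. left. apply ratio_coef_decr.
Qed.

Lemma ratio_coef_eventually_lt (r : R) :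
  2 / PI < r -> exists N, forall n, (N <= n)%nat -> ratio_coef n < r.
Proof.
  intros Hr.
  assert (HL := proj2 (is_lim_seq_spec _ _) ratio_coef_lim). simpl in HL.
  destruct (HL (mkposreal (r - 2 / PI) ltac:(lra))) as [N HN].
  exists N. intros n Hn. specialize (HN n Hn). simpl in HN. apply Rabs_def2 in HN. lra.
Qed.

(** * Power series of the numerator and denominator of the ratio *)

Definition sinhc_coef (n : nat) : R := / INR (fact (2 * n + 1)).

Definition bessel_coef (n : nat) : R := / (4 ^ n * INR (fact n) ^ 2).

Definition bessel_sq_coef (n : nat) : R :=
  INR (fact (2 * n)) / (4 ^ n * INR (fact n) ^ 4).

Lemma exp_coef_entire : entire (fun n => / INR (fact n)).
Proof. intros x. exists (exp x). apply is_exp_Reals. Qed.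

Lemma fact_le_INR (m n : nat) : (m <= n)%nat -> INR (fact m) <= INR (fact n).
Proof. intros H. apply le_INR, fact_le, H. Qed.

Lemma entire_sinhc : entire sinhc_coef.
Proof.
  apply entire_dominated with (1 := exp_coef_entire). intros n.
  unfold sinhc_coef. rewrite Rabs_pos_eq by (left; apply Rinv_0_lt_compat, INR_fact_lt_0).
  apply Rinv_le_contravar; [apply INR_fact_lt_0 | apply fact_le_INR; lia].
Qed.

Lemma entire_bessel : entire bessel_coef.
Proof.
  apply entire_dominated with (1 := exp_coef_entire). intros n.
  unfold bessel_coef.
  assert (H : 0 < INR (fact n)) by apply INR_fact_lt_0.
  assert (H4 : 1 <= 4 ^ n) by (apply pow_R1_Rle; lra).
  assert (H1 : 1 <= INR (fact n)) by (apply (fact_le_INR 0 n); lia).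
  assert (INR (fact n) <= INR (fact n) ^ 2) by (simpl; nra).
  assert (INR (fact n) <= 4 ^ n * INR (fact n) ^ 2) by nra.
  rewrite Rabs_pos_eq by (left; apply Rinv_0_lt_compat; lra).
  apply Rinv_le_contravar; lra.
Qed.

Lemma besselI0_PSeries (t : R) : besselI0 t = PSeries bessel_coef (t ^ 2).
Proof.
  apply Series_ext. intros n. unfold bessel_coef.
  rewrite !pow_mult. replace (2 ^ 2) with 4 by ring.
  unfold Rdiv. ring.
Qed.

(** The odd part of the exponential series. *)
Lemma sinh_PSeries (t : R) : sinh t = t * PSeries sinhc_coef (t ^ 2).
Proof.
  assert (Ee : entire (fun n => / INR (fact (2 * n)))).
  { apply entire_dominated with (1 := exp_coef_entire). intros n.
    rewrite Rabs_pos_eq by (left; apply Rinv_0_lt_compat, INR_fact_lt_0).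
    apply Rinv_le_contravar; [apply INR_fact_lt_0 | apply fact_le_INR; lia]. }
  assert (H : forall z, exp z = PSeries (fun n => / INR (fact (2 * n))) (z ^ 2) + z * PSeries sinhc_coef (z ^ 2)).
  { intros z. rewrite exp_Reals.
    apply (PSeries_odd_even (fun n => / INR (fact n)) z); [apply Ee | apply entire_sinhc]. }
  unfold sinh. rewrite (H t), (H (- t)).
  replace ((- t) ^ 2) with (t ^ 2) by ring. field.
Qed.

(** The product is half of the hyperbolic sine at [2 * t]. *)
Lemma cosh_sinh_PSeries (t : R) :
  cosh t * sinh t = t * PSeries (fun n => 4 ^ n * sinhc_coef n) (t ^ 2).
Proof.
  rewrite PSeries_dilate.
  replace (4 * t ^ 2) with ((2 * t) ^ 2) by ring.
  transitivity (sinh (2 * t) / 2); [|rewrite sinh_PSeries; field].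
  unfold sinh, cosh.
  replace (- (2 * t)) with (- t + - t) by ring. replace (2 * t) with (t + t) by ring.
  rewrite !exp_plus. field.
Qed.

Module BinomialSquares.
Import ssreflect ssrbool ssrnat bigop fintype binomial.

Lemma INR_sum (F : nat -> nat) (n : nat) :
  INR (\sum_(k < n.+1) F k)%N = sum_f_R0 (fun k => INR (F k)) n.
Proof.
  elim: n => [|n IH]; rewrite big_ord_recr /=; first by rewrite big_ord0.
  by rewrite -IH -plus_INR.
Qed.

Lemma INR_binomial (n k : nat) : (k <= n)%N -> INR 'C(n, k) = Binomial.C n k.
Proof.
  move=> Hk.
  have F : forall m, m`! = fact m by elim=> [|m IH] //; rewrite factS IH.
  have E : INR ('C(n, k) * (fact k * fact (n - k)))%N = INR (fact n).
  { by rewrite -!F bin_fact. }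
  rewrite !mult_INR in E. change (n - k)%N with (Nat.sub n k) in E.
  rewrite /Binomial.C -E. field. split; apply INR_fact_neq_0.
Qed.

Lemma sum_binomial_sq (n : nat) :
  sum_f_R0 (fun k => pow (Binomial.C n k) 2) n = Binomial.C (Nat.mul 2 n) n.
Proof.
  replace (Nat.mul 2 n) with (n + n)%N by (rewrite /addn /=; Lia.lia).
  rewrite -INR_binomial ?leq_addr // -Vandermonde.
  rewrite (INR_sum (fun k => 'C(n, k) * 'C(n, n - k))%N).
  apply: sum_eq => k Hk.
  have Hk' : (k <= n)%N by apply/leP.
  rewrite mult_INR !INR_binomial ?leq_subr // -(pascal_step1 n k Hk).
  simpl. ring.
Qed.
End BinomialSquares.

(** With [4 ^ n * n! ^ 2] as a common denominator the convolution is the sum of the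
    squares of the binomial coefficients of order [n]. *)
Lemma bessel_sq_coef_eq (n : nat) : PS_mult bessel_coef bessel_coef n = bessel_sq_coef n.
Proof.
  unfold PS_mult.
  transitivity (sum_f_R0 (fun k => Binomial.C n k ^ 2 * / (4 ^ n * INR (fact n) ^ 2)) n).
  - apply sum_eq. intros k Hk. unfold bessel_coef, Binomial.C.
    replace (4 ^ n) with (4 ^ k * 4 ^ (n - k)) by (rewrite <- pow_add; f_equal; lia).
    field. repeat split; try apply INR_fact_neq_0; apply pow_nonzero; lra.
  - rewrite <- scal_sum, BinomialSquares.sum_binomial_sq. unfold Binomial.C, bessel_sq_coef.
    replace (2 * n - n)%nat with n by lia.
    field. repeat split; try apply INR_fact_neq_0; apply pow_nonzero; lra.
Qed.

Lemma entire_bessel_sq : entire bessel_sq_coef.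
Proof.
  apply entire_ext with (1 := bessel_sq_coef_eq).
  intros x. apply ex_pseries_mult; apply entire_radius, entire_bessel.
Qed.

Lemma besselI0_sq_PSeries (t : R) : besselI0 t ^ 2 = PSeries bessel_sq_coef (t ^ 2).
Proof.
  rewrite <- (PSeries_ext _ _ _ bessel_sq_coef_eq).
  rewrite PSeries_mult by apply entire_radius, entire_bessel.
  rewrite besselI0_PSeries. ring.
Qed.

Definition den_coef (n : nat) : R := (4 ^ S n - 1) / INR (fact (2 * S n + 1)).

Lemma den_coef_pos (n : nat) : 0 < den_coef n.
Proof.
  apply Rdiv_lt_0_compat; [generalize (pow4_gt_1 n); lra | apply INR_fact_lt_0].
Qed.

Lemma entire_den : entire den_coef.
Proof.
  apply (entire_ext (PS_decr_1 (fun n => 4 ^ n * sinhc_coef n - sinhc_coef n))).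
  - intros n. unfold PS_decr_1, sinhc_coef, den_coef. field. apply INR_fact_neq_0.
  - apply entire_tail, entire_minus; [apply entire_dilate|]; apply entire_sinhc.
Qed.

Definition num_coef (n : nat) : R := ratio_coef n * den_coef n.

Lemma num_coef_eq (n : nat) : bessel_sq_coef (S n) - sinhc_coef (S n) = num_coef n.
Proof.
  unfold num_coef, ratio_coef, den_coef, bessel_sq_coef, sinhc_coef, wallis.
  replace (16 ^ S n) with (4 ^ S n * 4 ^ S n) by (rewrite <- Rpow_mult_distr; f_equal; lra).
  generalize (pow4_gt_1 n); intros.
  field. repeat split; try apply INR_fact_neq_0; lra.
Qed.

Lemma entire_num : entire num_coef.
Proof.
  apply (entire_ext (PS_decr_1 (fun n => bessel_sq_coef n - sinhc_coef n))).
  - apply num_coef_eq.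
  - apply entire_tail, entire_minus; [apply entire_bessel_sq | apply entire_sinhc].
Qed.

Lemma ratio_numerator (t : R) :
  t * besselI0 t ^ 2 - sinh t = t ^ 3 * PSeries num_coef (t ^ 2).
Proof.
  rewrite besselI0_sq_PSeries, sinh_PSeries.
  rewrite <- Rmult_minus_distr_l, <- PSeries_sub by (apply entire_bessel_sq || apply entire_sinhc).
  rewrite (PSeries_drop_zero _ num_coef); [ring| |apply num_coef_eq].
  unfold bessel_sq_coef, sinhc_coef. simpl. field.
Qed.

Lemma ratio_denominator (t : R) :
  (cosh t - 1) * sinh t = t ^ 3 * PSeries den_coef (t ^ 2).
Proof.
  replace ((cosh t - 1) * sinh t) with (cosh t * sinh t - sinh t) by ring.
  rewrite cosh_sinh_PSeries, sinh_PSeries.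
  rewrite <- Rmult_minus_distr_l, <- PSeries_sub by (try apply entire_dilate; apply entire_sinhc).
  rewrite (PSeries_drop_zero _ den_coef); [ring| |].
  - simpl. ring.
  - intros n. unfold sinhc_coef, den_coef. field. apply INR_fact_neq_0.
Qed.

Lemma ratio_PSeries (t : R) :
  0 < t -> ratio t = PSeries num_coef (t ^ 2) / PSeries den_coef (t ^ 2).
Proof.
  intros Ht. unfold ratio. rewrite ratio_numerator, ratio_denominator.
  assert (0 < PSeries den_coef (t ^ 2)).
  { apply PSeries_pos; [apply den_coef_pos | apply entire_den | apply pow_le; lra]. }
  field. lra.
Qed.

(** * Range and critical point of the ratio *)

Definition quotient (x : R) : R := PSeries num_coef x / PSeries den_coef x.

Lemma den_pos (x : R) : 0 <= x -> 0 < PSeries den_coef x.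
Proof. apply PSeries_pos; [apply den_coef_pos | apply entire_den]. Qed.

Lemma quotient_le_iff (r x : R) :
  0 <= x -> quotient x <= r <-> PSeries num_coef x <= r * PSeries den_coef x.
Proof.
  intros Hx. unfold quotient. generalize (den_pos x Hx); intros Hd.
  split; intros H.
  - apply Rmult_le_compat_r with (r := PSeries den_coef x) in H; [|lra].
    replace (PSeries num_coef x / PSeries den_coef x * PSeries den_coef x) with (PSeries num_coef x) in H
      by (field; lra). exact H.
  - apply Rmult_le_reg_r with (PSeries den_coef x); [exact Hd|].
    replace (PSeries num_coef x / PSeries den_coef x * PSeries den_coef x) with (PSeries num_coef x)
      by (field; lra). exact H.
Qed.

Lemma entire_level (r : R) : entire (fun n => (ratio_coef n - r) * den_coef n).
Proof.
  apply (entire_ext (fun n => num_coef n - r * den_coef n)).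
  - intros n. unfold num_coef. ring.
  - apply entire_minus; [apply entire_num | apply entire_scal, entire_den].
Qed.

(** Comparing the quotient with a constant [r] is a question about the signs of
    [ratio_coef n - r]. *)
Lemma PSeries_level (r x : R) :
  PSeries (fun n => (ratio_coef n - r) * den_coef n) x =
  PSeries num_coef x - r * PSeries den_coef x.
Proof.
  rewrite <- (PSeries_scal r den_coef x : _ = r * PSeries den_coef x).
  rewrite <- PSeries_sub; [|apply entire_num | apply entire_scal, entire_den].
  apply PSeries_ext. intros n. unfold num_coef, PS_scal, scal; simpl; unfold mult; simpl. ring.
Qed.

Lemma quotient_gt_two_over_PI (x : R) : 0 <= x -> 2 / PI < quotient x.
Proof.
  intros Hx. apply Rnot_le_lt. rewrite quotient_le_iff by exact Hx. apply Rlt_not_le.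
  assert (0 < PSeries (fun n => (ratio_coef n - 2 / PI) * den_coef n) x);
    [|rewrite PSeries_level in H; lra].
  apply PSeries_pos; [|apply entire_level | exact Hx].
  intros n. generalize (ratio_coef_gt n) (den_coef_pos n); intros. nra.
Qed.

(** If [r > 2 / PI], all but finitely many coefficients of [P - r * Q] are negative. *)
Lemma quotient_approaches_two_over_PI (r : R) :
  2 / PI < r -> exists x, 0 < x /\ quotient x <= r.
Proof.
  intros Hr. destruct (ratio_coef_eventually_lt r Hr) as [N HN].
  destruct (eventually_negative N _ (entire_level r)) as (e & Y & He & HY & H).
  { intros n Hn. generalize (HN n Hn) (den_coef_pos n); intros. nra. }
  exists Y. split; [exact HY|]. rewrite quotient_le_iff by lra.
  specialize (H Y ltac:(lra)). rewrite PSeries_level in H. lra.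
Qed.

Lemma ratio_derive (t : R) :
  0 < t ->
  is_derive ratio t
    (2 * t * (wronskian num_coef den_coef (t ^ 2) / PSeries den_coef (t ^ 2) ^ 2)).
Proof.
  intros Ht.
  apply (is_derive_ext_loc (fun z => quotient (z ^ 2))).
  - exists (mkposreal t Ht). intros z Hz.
    unfold ball in Hz; simpl in Hz; unfold AbsRing_ball, abs, minus, plus, opp in Hz; simpl in Hz.
    apply Rabs_def2 in Hz. symmetry. apply ratio_PSeries. lra.
  - apply (is_derive_comp quotient (fun z => z ^ 2) t).
    + apply quotient_deriv; [apply entire_num | apply entire_den |].
      generalize (den_pos (t ^ 2) (pow2_ge_0 t)); lra.
    + auto_derive; [exact I | ring].
Qed.

Lemma critical_point_iff (t : R) :
  critical_point t <-> 0 < t /\ wronskian num_coef den_coef (t ^ 2) = 0.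
Proof.
  unfold critical_point.
  assert (Hd : 0 < PSeries den_coef (t ^ 2) ^ 2) by (apply pow_lt, den_pos, pow2_ge_0).
  split; intros [Ht H]; (split; [exact Ht|]).
  - apply is_derive_unique in H.
    rewrite (is_derive_unique _ _ _ (ratio_derive t Ht)) in H.
    apply Rmult_eq_reg_l with (2 * t / PSeries den_coef (t ^ 2) ^ 2).
    + rewrite Rmult_0_r, <- H. field. intros E. rewrite E in Hd. simpl in Hd. lra.
    + apply Rgt_not_eq, Rdiv_lt_0_compat; lra.
  - generalize (ratio_derive t Ht). rewrite H.
    replace (2 * t * (0 / PSeries den_coef (t ^ 2) ^ 2)) with 0; [auto|].
    unfold Rdiv. ring.
Qed.

(** In the variable [x = t ^ 2] the derivative of the ratio is a positive multiple of
    the wronskian, so its only zero is the square root of the zero of the latter. *)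
Lemma ratio_unimodal :
  exists t0 : R, unique critical_point t0 /\
    forall t, 0 < t -> t <> t0 -> ratio t < ratio t0.
Proof.
  destruct (quotient_approaches_two_over_PI (2 / 3) two_over_PI_lt) as (X & HX & HqX).
  rewrite quotient_le_iff in HqX by lra.
  assert (H01 : ratio_coef 0 < ratio_coef 1) by (rewrite ratio_coef_0, ratio_coef_1; lra).
  rewrite <- ratio_coef_0 in HqX.
  destruct (wronskian_one_root ratio_coef den_coef entire_den entire_num den_coef_pos
    H01 ratio_coef_decr X HX HqX) as (x0 & Hx0 & HW & Hl & Hr).
  assert (Ht0 : 0 < sqrt x0) by (apply sqrt_lt_R0, Hx0).
  assert (Hs : sqrt x0 ^ 2 = x0) by (apply pow2_sqrt; lra).
  exists (sqrt x0). split; [split|].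
  - apply critical_point_iff. rewrite Hs. auto.
  - intros t Ht. apply critical_point_iff in Ht. destruct Ht as [Ht HWt].
    assert (Ht2 : 0 < t ^ 2) by (apply pow_lt, Ht).
    rewrite <- (sqrt_pow2 t) by lra. f_equal.
    destruct (Rtotal_order (t ^ 2) x0) as [H | [H | H]]; [|congruence|].
    + generalize (Hl _ (conj Ht2 H)). unfold num_coef in HWt. lra.
    + generalize (Hr _ H). unfold num_coef in HWt. lra.
  - intros t Ht Hne. rewrite !ratio_PSeries, Hs by assumption.
    apply (quotient_max ratio_coef den_coef entire_den entire_num den_coef_pos x0); auto.
    + apply pow_lt, Ht.
    + intros E. apply Hne. rewrite <- E. symmetry. apply sqrt_pow2. lra.
Qed.

Lemma ratio_gt (t : R) : 0 < t -> 2 / PI < ratio t.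
Proof.
  intros Ht. rewrite ratio_PSeries by exact Ht. apply quotient_gt_two_over_PI, pow2_ge_0.
Qed.

Lemma below_ratio_iff (l : R) :
  (forall t, 0 < t -> l < ratio t) <-> l <= 2 / PI.
Proof.
  split.
  - intros H. apply Rnot_lt_le. intros Hl.
    destruct (quotient_approaches_two_over_PI l Hl) as (x & Hx & Hq).
    specialize (H (sqrt x) (sqrt_lt_R0 x Hx)).
    rewrite ratio_PSeries, pow2_sqrt in H by (try apply sqrt_lt_R0; lra).
    unfold quotient in Hq. lra.
  - intros H t Ht. generalize (ratio_gt t Ht). lra.
Qed.

(** * Enclosure of the maximum *)

(** Each exact value follows from the preceding one, so that no factorial has to be
    evaluated. *)
Lemma den_coef_succ (n : nat) :
  den_coef (S n) = den_coef n * ((4 * 4 ^ S n - 1) / (4 ^ S n - 1)) /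
    ((2 * INR n + 4) * (2 * INR n + 5)).
Proof.
  unfold den_coef.
  replace (2 * S (S n) + 1)%nat with (S (S (2 * S n + 1))) by lia.
  set (m := (2 * S n + 1)%nat).
  assert (Hm : INR m = 2 * INR n + 3).
  { unfold m. rewrite plus_INR, mult_INR, (S_INR n). simpl INR. ring. }
  rewrite (fact_simpl (S m)), (fact_simpl m), !mult_INR, !S_INR, Hm.
  change (4 ^ S (S n)) with (4 * 4 ^ S n).
  generalize (pow4_gt_1 n) (pos_INR n); intros.
  field. repeat split; try lra. apply INR_fact_neq_0.
Qed.

Lemma den_coef_values :
  den_coef 0 = 1 / 2 /\
  den_coef 1 = 1 / 8 /\
  den_coef 2 = 1 / 80 /\
  den_coef 3 = 17 / 24192 /\
  den_coef 4 = 31 / 1209600 /\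
  den_coef 5 = 1 / 1520640 /\
  den_coef 6 = 5461 / 435891456000 /\
  den_coef 7 = 257 / 1394852659200 /\
  den_coef 8 = 73 / 33874993152000 /\
  den_coef 9 = 1271 / 61928414753587200.
Proof.
  assert (H0 : den_coef 0 = 1 / 2) by (unfold den_coef; simpl; field).
  assert (H1 : den_coef 1 = 1 / 8) by (rewrite den_coef_succ, H0; simpl; field).
  assert (H2 : den_coef 2 = 1 / 80) by (rewrite den_coef_succ, H1; simpl; field).
  assert (H3 : den_coef 3 = 17 / 24192) by (rewrite den_coef_succ, H2; simpl; field).
  assert (H4 : den_coef 4 = 31 / 1209600) by (rewrite den_coef_succ, H3; simpl; field).
  assert (H5 : den_coef 5 = 1 / 1520640) by (rewrite den_coef_succ, H4; simpl; field).
  assert (H6 : den_coef 6 = 5461 / 435891456000) by (rewrite den_coef_succ, H5; simpl; field).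
  assert (H7 : den_coef 7 = 257 / 1394852659200) by (rewrite den_coef_succ, H6; simpl; field).
  assert (H8 : den_coef 8 = 73 / 33874993152000) by (rewrite den_coef_succ, H7; simpl; field).
  assert (H9 : den_coef 9 = 1271 / 61928414753587200) by (rewrite den_coef_succ, H8; simpl; field).
  tauto.
Qed.

Lemma ratio_coef_values :
  ratio_coef 2 = 19 / 28 /\
  ratio_coef 3 = 10961 / 16320 /\
  ratio_coef 4 = 43595 / 65472 /\
  ratio_coef 5 = 693437 / 1048320 /\
  ratio_coef 6 = 2760359 / 4194048 /\
  ratio_coef 7 = 703940441 / 1073725440 /\
  ratio_coef 8 = 935706697 / 1431650304.
Proof.
  assert (W4 : wallis 4 = 11025 / 16384) by (rewrite wallis_succ, wallis_3; simpl; field).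
  assert (W5 : wallis 5 = 43659 / 65536) by (rewrite wallis_succ, W4; simpl; field).
  assert (W6 : wallis 6 = 693693 / 1048576) by (rewrite wallis_succ, W5; simpl; field).
  assert (W7 : wallis 7 = 2760615 / 4194304) by (rewrite wallis_succ, W6; simpl; field).
  assert (W8 : wallis 8 = 703956825 / 1073741824) by (rewrite wallis_succ, W7; simpl; field).
  assert (W9 : wallis 9 = 2807136475 / 4294967296) by (rewrite wallis_succ, W8; simpl; field).
  unfold ratio_coef. rewrite wallis_3, W4, W5, W6, W7, W8, W9. repeat split; field.
Qed.

(** The coefficients [ratio_coef n - r] of the difference [P - r * Q] are negative
    from index 3 on, so truncating after degree 8 can only increase it.  The truncated
    polynomial is negative but nearly has a double zero at the square of the critical
    point; dividing it by [(x - 147 / 20) ^ 2], with 147/20 close to that zero, leaves a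
    quotient and a remainder all of whose coefficients have the same sign; they are
    written below over a common denominator. *)
Lemma quotient_upper (x : R) :
  0 <= x -> PSeries num_coef x <= 676645 / 1000000 * PSeries den_coef x.
Proof.
  intros Hx.
  assert (H : PSeries (fun n => (ratio_coef n - 676645 / 1000000) * den_coef n) x <= 0);
    [|rewrite PSeries_level in H; lra].
  rewrite (PSeries_split _ 8) by apply entire_level.
  destruct den_coef_values as (D0 & D1 & D2 & D3 & D4 & D5 & D6 & D7 & D8 & D9).
  destruct ratio_coef_values as (C2 & C3 & C4 & C5 & C6 & C7 & C8).
  assert (Htail : PSeries (fun k => (ratio_coef (9 + k) - 676645 / 1000000) * den_coef (9 + k)) x <= 0).
  { rewrite <- (PSeries_const_0 x). apply PSeries_coef_le; [| | |exact Hx].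
    - apply (entire_shift 9 (fun n => (ratio_coef n - 676645 / 1000000) * den_coef n)), entire_level.
    - intros y. apply CV_radius_inside. rewrite CV_radius_const_0. exact I.
    - intros k. generalize (den_coef_pos (9 + k)).
      assert (ratio_coef (9 + k) < ratio_coef 3).
      { apply (strictly_decreasing_lt (fun n => ratio_coef (S n)) ratio_coef_decr 2 (8 + k)). lia. }
      nra. }
  assert (Hp : forall n, 0 <= x ^ n) by (intros; apply pow_le, Hx).
  assert (Hsum : sum_f_R0 (fun k => (ratio_coef k - 676645 / 1000000) * den_coef k * x ^ k) 8 <= 0).
  { cbn [sum_f_R0].
    rewrite D0, D1, D2, D3, D4, D5, D6, D7, D8, ratio_coef_0, ratio_coef_1, C2, C3, C4, C5, C6, C7, C8.
    pose (r :=
      4906069247839785857232870142800 +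
         512126703860268557865039984000 * x ^ 1 +
         24848557270518922473103200000 * x ^ 2 +
         748724874456373475673600000 * x ^ 3 +
         15764155837508692032000000 * x ^ 4 +
         244847937050350080000000 * x ^ 5 +
         2640985836006400000000 * x ^ 6).
    assert (Hr : 0 <= (x - 147 / 20) ^ 2 * r).
    { generalize (Hp 1%nat) (Hp 2%nat) (Hp 3%nat) (Hp 4%nat) (Hp 5%nat) (Hp 6%nat); intros.
      apply Rmult_le_pos; [apply pow2_ge_0 | unfold r; lra]. }
    match goal with |- ?s <= 0 => replace s with
      (- (((x - 147 / 20) ^ 2 * r +
           123885555542790364437272710587 + 19282341622983393259068563520 * x) /
          53147555335954759680000000000000000)) by (unfold r; field) end.
    lra. }
  generalize (Hp 9%nat); nra.
Qed.

(** The point 22/3 is close to the square of the critical point.  Beyond degree 8 the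
    coefficients of the numerator are positive, and each term of the denominator is
    at most half of the preceding one, so the tail is negligible. *)
Lemma quotient_lower :
  676635 / 1000000 * PSeries den_coef (22 / 3) <= PSeries num_coef (22 / 3).
Proof.
  assert (H : 0 <= PSeries (fun n => (ratio_coef n - 676635 / 1000000) * den_coef n) (22 / 3));
    [|rewrite PSeries_level in H; lra].
  rewrite (PSeries_split _ 8) by apply entire_level.
  destruct den_coef_values as (D0 & D1 & D2 & D3 & D4 & D5 & D6 & D7 & D8 & D9).
  destruct ratio_coef_values as (C2 & C3 & C4 & C5 & C6 & C7 & C8).
  assert (Hgeo : PSeries (fun k => den_coef (9 + k)) (22 / 3) <= 2 * den_coef 9).
  { apply (PSeries_le_geometric (fun k => den_coef (9 + k))).
    - intros n. left. apply den_coef_pos.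
    - apply (entire_shift 9), entire_den.
    - lra.
    - intros n. replace (9 + S n)%nat with (S (9 + n)) by lia.
      rewrite den_coef_succ. set (m := (9 + n)%nat).
      assert (Hm : 9 <= INR m) by (generalize (le_INR 9 m ltac:(unfold m; lia)); simpl INR; lra).
      assert (H4 := pow4_gt_1 m). assert (Hd := den_coef_pos m).
      assert (4 <= 4 ^ S m) by (generalize (pow_R1_Rle 4 m ltac:(lra)); simpl; lra).
      apply Rmult_le_reg_r with ((4 ^ S m - 1) * ((2 * INR m + 4) * (2 * INR m + 5))).
      { apply Rmult_lt_0_compat; nra. }
      match goal with |- ?l <= _ => replace l with
        (den_coef m * (4 * 4 ^ S m - 1) * (22 / 3)) by (field; lra) end.
      assert (4 * 4 ^ S m - 1 <= 5 * (4 ^ S m - 1)) by lra.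
      assert (22 * 23 <= (2 * INR m + 4) * (2 * INR m + 5)) by nra.
      assert ((4 ^ S m - 1) * (22 * 23) <= (4 ^ S m - 1) * ((2 * INR m + 4) * (2 * INR m + 5)))
        by (apply Rmult_le_compat_l; lra).
      unfold Rdiv. rewrite !Rmult_assoc. apply Rmult_le_compat_l; lra. }
  assert (Htail : - PSeries (fun k => den_coef (9 + k)) (22 / 3) <=
    PSeries (fun k => (ratio_coef (9 + k) - 676635 / 1000000) * den_coef (9 + k)) (22 / 3)).
  { rewrite <- PSeries_opp. apply PSeries_coef_le; [| | |lra].
    - apply (entire_ext (fun k => -1 * den_coef (9 + k))).
      + intros n. unfold PS_opp, opp; simpl. ring.
      + apply entire_scal, (entire_shift 9), entire_den.
    - apply (entire_shift 9 (fun n => (ratio_coef n - 676635 / 1000000) * den_coef n)), entire_level.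
    - intros k. unfold PS_opp, opp; simpl opp.
      change (- den_coef (9 + k) <= (ratio_coef (9 + k) - 676635 / 1000000) * den_coef (9 + k)).
      assert (Hpi : 0 < 2 / PI) by (apply Rdiv_lt_0_compat; [lra | apply PI_RGT_0]).
      generalize (den_coef_pos (9 + k)) (ratio_coef_gt (9 + k)). nra. }
  assert (H9 : - (2 * den_coef 9) <=
    PSeries (fun k => (ratio_coef (9 + k) - 676635 / 1000000) * den_coef (9 + k)) (22 / 3)) by lra.
  apply Rmult_le_compat_l with (r := (22 / 3) ^ 9) in H9; [|apply pow_le; lra].
  eapply Rle_trans; [|apply Rplus_le_compat_l, H9].
  cbn [sum_f_R0].
  rewrite D0, D1, D2, D3, D4, D5, D6, D7, D8, D9, ratio_coef_0, ratio_coef_1, C2, C3, C4, C5, C6, C7, C8.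
  lra.
Qed.

Lemma ratio_upper (t : R) : 0 < t -> ratio t <= 676645 / 1000000.
Proof.
  intros Ht. rewrite ratio_PSeries by exact Ht.
  apply quotient_le_iff; [apply pow2_ge_0 | apply quotient_upper, pow2_ge_0].
Qed.

Lemma ratio_lower : 676635 / 1000000 <= ratio (sqrt (22 / 3)).
Proof.
  rewrite ratio_PSeries by (apply sqrt_lt_R0; lra).
  rewrite pow2_sqrt by lra.
  apply Rmult_le_reg_r with (PSeries den_coef (22 / 3)); [apply den_pos; lra|].
  replace (PSeries num_coef (22 / 3) / PSeries den_coef (22 / 3) * PSeries den_coef (22 / 3))
    with (PSeries num_coef (22 / 3)); [apply quotient_lower|].
  field. generalize (den_pos (22 / 3)); lra.
Qed.

(** * From the ratio to the square-root bounds *)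

Lemma besselI0_pos (t : R) : 0 < besselI0 t.
Proof.
  rewrite besselI0_PSeries. apply PSeries_pos; [|apply entire_bessel | apply pow2_ge_0].
  intros n. apply Rinv_0_lt_compat, Rmult_lt_0_compat; apply pow_lt; [lra | apply INR_fact_lt_0].
Qed.

(** The radicand is affine and increasing in [p], and equals [besselI0 t ^ 2] at
    [p = ratio t]. *)
Lemma radicand_eq (p t : R) :
  0 < t -> exists D, 0 < D /\ radicand p t = besselI0 t ^ 2 + (p - ratio t) * D.
Proof.
  intros Ht. exists (t ^ 2 * PSeries den_coef (t ^ 2)).
  assert (Hd := den_pos (t ^ 2) (pow2_ge_0 t)).
  split; [apply Rmult_lt_0_compat; [apply pow_lt, Ht | exact Hd]|].
  rewrite ratio_PSeries by exact Ht.
  generalize (ratio_numerator t) (ratio_denominator t). unfold radicand.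
  intros Hn Hde.
  apply Rmult_eq_reg_r with t; [|lra].
  transitivity (p * ((cosh t - 1) * sinh t) + sinh t); [field; lra|].
  rewrite Hde. replace (sinh t) with (t * besselI0 t ^ 2 - t ^ 3 * PSeries num_coef (t ^ 2)) by lra.
  field. lra.
Qed.

(** A negative radicand causes no exception: its root is 0, below the Bessel function,
    and the radicand is then below the square of the Bessel function as well. *)
Lemma sqrt_bound_lt_iff (p t : R) : 0 < t -> sqrt_bound p t < besselI0 t <-> p < ratio t.
Proof.
  intros Ht. destruct (radicand_eq p t Ht) as (D & HD & E).
  assert (Hp := besselI0_pos t). unfold sqrt_bound.
  rewrite <- (sqrt_pow2 (besselI0 t)) at 1 by lra. split; intros H.
  - apply sqrt_lt_0_alt in H. apply Rnot_le_lt. intros Hn. nra.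
  - destruct (Rle_lt_dec 0 (radicand p t)) as [Hr | Hr].
    + apply sqrt_lt_1_alt. split; [exact Hr | nra].
    + rewrite sqrt_neg_0, sqrt_pow2 by lra. exact Hp.
Qed.

Lemma sqrt_bound_gt_iff (p t : R) : 0 < t -> besselI0 t < sqrt_bound p t <-> ratio t < p.
Proof.
  intros Ht. destruct (radicand_eq p t Ht) as (D & HD & E).
  assert (Hp := besselI0_pos t). unfold sqrt_bound.
  rewrite <- (sqrt_pow2 (besselI0 t)) at 1 by lra. split; intros H.
  - apply sqrt_lt_0_alt in H. apply Rnot_le_lt. intros Hn. nra.
  - apply sqrt_lt_1_alt. split; [apply pow2_ge_0 | nra].
Qed.

Lemma sqrt_bound_eq_iff (p t : R) : 0 < t -> besselI0 t = sqrt_bound p t <-> p = ratio t.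
Proof.
  intros Ht. generalize (sqrt_bound_lt_iff p t Ht) (sqrt_bound_gt_iff p t Ht).
  intros [H1 H1'] [H2 H2']. split; intros H.
  - destruct (Rtotal_order p (ratio t)) as [L | [L | L]]; [|exact L|].
    + apply H1' in L. lra.
    + apply H2' in L. lra.
  - destruct (Rtotal_order (besselI0 t) (sqrt_bound p t)) as [L | [L | L]]; [|exact L|].
    + apply H2 in L. lra.
    + apply H1 in L. lra.
Qed.

Lemma sqrt_bound_ge_iff (p t : R) : 0 < t -> besselI0 t <= sqrt_bound p t <-> ratio t <= p.
Proof.
  intros Ht. generalize (sqrt_bound_lt_iff p t Ht). intros [H1 H2]. split; intros H; apply Rnot_lt_le; intros L.
  - apply H2 in L. lra.
  - apply H1 in L. lra.
Qed.

Lemma sinhc_pos (t : R) : 0 < t -> 0 < sinh t / t.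
Proof.
  intros Ht. apply Rdiv_lt_0_compat; [|exact Ht].
  rewrite <- sinh_0. apply sinh_lt, Ht.
Qed.

(** For negative [p] the radicand has the sign of [1 - / p - cosh t]; the point chosen
    makes the exponential lower bound [1 + t <= exp t] exceed [2 * (1 - / p)]. *)
Lemma sqrt_defined_iff (p : R) : (forall t, 0 < t -> sqrt_defined p t) <-> 0 <= p.
Proof.
  unfold sqrt_defined, radicand. split.
  - intros H. apply Rnot_lt_le. intros Hp.
    assert (Hi : 0 < - / p) by (generalize (Rinv_lt_0_compat p Hp); lra).
    set (t := 2 * (1 - / p)).
    assert (Ht : 0 < t) by (unfold t; lra).
    specialize (H t Ht). generalize (sinhc_pos t Ht); intros Hs.
    assert (Hc : 1 - / p < cosh t).
    { unfold cosh. generalize (exp_ineq1 t ltac:(lra)) (exp_pos (- t)). unfold t at 1. lra. }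
    assert (p * cosh t < p * (1 - / p)) by nra.
    replace (p * (1 - / p)) with (p - 1) in H0 by (field; lra).
    nra.
  - intros Hp t Ht. apply Rmult_le_pos; [|left; apply sinhc_pos, Ht].
    assert (1 <= cosh t); [|nra].
    unfold cosh. generalize (exp_ineq1_le t) (exp_ineq1_le (- t)). lra.
Qed.

(* At delta = delta0 = ratio t0 one has sqrt_bound delta0 t0 = besselI0 t0, so the
   right-hand strict inequality cannot hold at t = t0.  Hence the three parts:
   strict for delta > delta0, non-strict for delta >= delta0, and equality in
   the closed range occurring only for delta = delta0 at t = t0. *)
Theorem theorem3 :
  exists t0 : R,
    unique critical_point t0 /\
    let delta0 := ratio t0 in
    Rabs (delta0 - 67664 / 100000) <= 5 / 1000000 /\
    (forall lambda delta : R,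
       (forall t : R, 0 < t ->
          sqrt_defined lambda t /\ sqrt_defined delta t /\
          sqrt_bound lambda t < besselI0 t < sqrt_bound delta t) <->
       (0 <= lambda <= 2 / PI /\ delta0 < delta)) /\
    (forall lambda delta : R,
       (forall t : R, 0 < t ->
          sqrt_defined lambda t /\ sqrt_defined delta t /\
          sqrt_bound lambda t < besselI0 t <= sqrt_bound delta t) <->
       (0 <= lambda <= 2 / PI /\ delta0 <= delta)) /\
    (forall delta t : R, delta0 <= delta -> 0 < t ->
       (besselI0 t = sqrt_bound delta t <-> (delta = delta0 /\ t = t0))).
Proof.
  destruct ratio_unimodal as (t0 & Hu & Hmax).
  assert (Ht0 : 0 < t0) by apply Hu.
  assert (Hmax' : forall t, 0 < t -> ratio t <= ratio t0).
  { intros t Ht. destruct (Req_dec t t0) as [-> | Hne]; [lra | left; auto]. }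
  assert (Hpos : 0 < ratio t0).
  { apply Rlt_trans with (2 := ratio_gt t0 Ht0). apply Rdiv_lt_0_compat; [lra | apply PI_RGT_0]. }
  exists t0. split; [exact Hu|]. cbv zeta. split; [|split; [|split]].
  - assert (H1 := ratio_upper t0 Ht0).
    assert (H2 := Hmax' (sqrt (22 / 3)) (sqrt_lt_R0 (22 / 3) ltac:(lra))).
    assert (H3 := ratio_lower).
    apply Rabs_le. lra.
  - intros lambda delta. split.
    + intros H. split; [split|].
      * apply sqrt_defined_iff. intros t Ht. apply H, Ht.
      * apply below_ratio_iff. intros t Ht. apply sqrt_bound_lt_iff; [exact Ht | apply H, Ht].
      * apply sqrt_bound_gt_iff; [exact Ht0 | apply H, Ht0].
    + intros [[Hl Hl'] Hd] t Ht. repeat split.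
      * apply sqrt_defined_iff; assumption.
      * apply sqrt_defined_iff; [lra | assumption].
      * apply sqrt_bound_lt_iff; [exact Ht | apply below_ratio_iff; assumption].
      * apply sqrt_bound_gt_iff; [exact Ht|]. specialize (Hmax' t Ht). lra.
  - intros lambda delta. split.
    + intros H. split; [split|].
      * apply sqrt_defined_iff. intros t Ht. apply H, Ht.
      * apply below_ratio_iff. intros t Ht. apply sqrt_bound_lt_iff; [exact Ht | apply H, Ht].
      * apply sqrt_bound_ge_iff; [exact Ht0 | apply H, Ht0].
    + intros [[Hl Hl'] Hd] t Ht. repeat split.
      * apply sqrt_defined_iff; assumption.
      * apply sqrt_defined_iff; [lra | assumption].
      * apply sqrt_bound_lt_iff; [exact Ht | apply below_ratio_iff; assumption].
      * apply sqrt_bound_ge_iff; [exact Ht|]. specialize (Hmax' t Ht). lra.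
  - intros delta t Hd Ht. rewrite sqrt_bound_eq_iff by exact Ht. split.
    + intros E. destruct (Req_dec t t0) as [-> | Hne]; [auto|].
      specialize (Hmax t Ht Hne). lra.
    + intros [-> ->]. reflexivity.
Qed.
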